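(* Assume that $\mathbf b\in\mathbf H$, and let $f$ be a map of the set $W$ of points of $\mathfrak B_1$ into itself. The following conditions are equivalent. (i) $f\in\mathrm{Aut}(\mathfrak B_1)$. (ii) There are $\varphi\in\Gamma L(W)$ and a vector $\omega\in W$ such that $f(x)=\varphi(x)+\omega$ for each $x\in W$, $\varphi$ preserves $\perp_{\mathbf H}$, and $$\xi_0(x,y)=\pi_1(y)\ \Longrightarrow\ \xi_0(\varphi(x),\varphi(y))+\xi_0(\omega,\varphi(y))=\pi_1(\varphi(y))$$ holds for all $x,y\in W$, where $\pi_1$ is the projection on the 1st coordinate.
   Context: Setting. $\mathfrak F$ is a perfect field of characteristic $2$, $\mathbb V$ is a vector space over $\mathfrak F$ of finite dimension $n$, and $\mathfrak P$ is the projective space of $\mathbb V$. Lines of $\mathfrak P$ have at least $6$ points. $\xi$ is a nondegenerate symmetric bilinear form on $\mathbb V$ which is not alternating, and $\langle u\rangle\perp\langle v\rangle$ means $\xi(u,v)=0$. The set $\mathbf H$ of selfconjugate points ($p\perp p$) is then a hyperplane with pole a point $\mathbf b$ (so $\mathbf b^\perp=\mathbf H$). $\perp_{\mathbf H}$ is the restriction of $\perp$ to $\mathbf H$. A subspace $U$ of $\mathfrak P$ is regular if $U\cap U^\perp=\emptyset$, where $U^\perp=\{p:p\perp q\text{ for all }q\in U\}$; regular points are exactly the points not on $\mathbf H$. When $\mathbf b\in\mathbf H$, $n=2k$ is even for some integer $k$. Coordinates $[x_0,x_1,\dots,x_{2k-1}]$ are chosen so that $$\xi([x_0,\dots,x_{2k-1}],[y_0,\dots,y_{2k-1}])=x_0y_0+\sum_{i=0}^{k-1}(x_{2i}y_{2i+1}+x_{2i+1}y_{2i}),$$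 so $\mathbf H$ is given by $x_0=0$ and $\mathbf b=[0,1,0,\dots,0]$. $W=\{x_0=0\}$ is the vector subspace of $\mathbb V$ corresponding to $\mathbf H$; its vectors are written $x=(x_1,\dots,x_{2k-1})$ and $\pi_1(x)=x_1$. $\xi_0$ is the restriction of $\xi$ to $W$. $\Gamma L(W)$ is the group of semilinear bijections of $W$, acting on $\mathbf H$ by $\langle u\rangle\mapsto\langle\varphi(u)\rangle$; $\varphi$ preserves $\perp_{\mathbf H}$ if this action does. $\mathfrak B_1$ is the point-line structure with points the regular points different from $\mathbf b$ (here: all points not on $\mathbf H$), lines the regular lines not contained in $\mathbf H$, and natural incidence. The point $[1,x]$, $x\in W$, is identified with the vector $x$, so the point set of $\mathfrak B_1$ is $W$.
   Formalization: The formal statement assumes k ≥ 2 (n ≥ 4); for k = 1 the structure 𝔅₁ is a single line containing all its points, so every permutation of W is an automorphism and the equivalence fails. *)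

(* Defs.v *)
From mathcomp Require Import all_boot all_order all_algebra.
From mathcomp Require Import sesquilinear.
From mathcomp Require Import boolp classical_sets functions.

Set Implicit Arguments.
Unset Strict Implicit.
Unset Printing Implicit Defensive.

Import GRing.Theory.
Local Open Scope classical_set_scope.
Local Open Scope ring_scope.

Definition perfect_field (F : fieldType) : Prop :=
  forall p : nat, p \in [pchar F] -> forall x : F, exists y : F, y ^+ p = x.

(* Point-line structures and their automorphisms.  The points and lines are   *)
(* subsets of ambient types, so an automorphism is a map of the ambient type  *)
(* of points; its values outside the point set are irrelevant.                *)
Record point_line (P L : Type) := PointLine {
  pl_points : set P;
  pl_lines : set L;
  incident : P -> L -> Prop }.

Definition automorphism (P L : Type) (S : point_line P L) (g : P -> P) : Prop :=
  set_bij (pl_points S) (pl_points S) g /\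
  exists2 h : L -> L, set_bij (pl_lines S) (pl_lines S) h &
    forall p l, pl_points S p -> pl_lines S l ->
      (incident S p l <-> incident S (g p) (h l)).

(* Subspaces of the projective space of V are represented by the vector       *)
(* subspaces of V, the empty one by 0%VS.                                     *)
Section ProjectiveSpace.
Variables (F : fieldType) (V : vectType F).

Definition ppoint : set {vspace V} := [set p | \dim p = 1%N].
Definition pline : set {vspace V} := [set l | \dim l = 2%N].

Definition points_on (U : {vspace V}) : set {vspace V} :=
  [set p | ppoint p /\ (p <= U)%VS].

Definition at_least_points (m : nat) (U : {vspace V}) : Prop :=
  exists s : seq {vspace V},
    [/\ uniq s, size s = m & forall p, p \in s -> points_on U p].

Variable xi : {symmetric V}.

Definition alternating : Prop := forall u : V, xi u u = 0.

Definition perp (p q : {vspace V}) : Prop :=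
  forall u v, u \in p -> v \in q -> xi u v = 0.

Definition perp_set (U : {vspace V}) : set {vspace V} :=
  [set p | ppoint p /\ forall q, points_on U q -> perp p q].

Definition selfconjugate : set {vspace V} := [set p | ppoint p /\ perp p p].

Definition regular (U : {vspace V}) : Prop :=
  points_on U `&` perp_set U = set0.

Definition B1 (b : {vspace V}) : point_line {vspace V} {vspace V} := {|
  pl_points := [set p | [/\ ppoint p, regular p & p <> b]];
  pl_lines := [set l | [/\ pline l, regular l &
                          ~ points_on l `<=` selfconjugate]];
  incident := fun p l => (p <= l)%VS |}.

End ProjectiveSpace.

Section Coordinates.
Variables (F : fieldType) (V : vectType F) (n : nat) (e : n.-tuple V).

(* The i-th coordinate of v in the basis e (junk value 0 when n <= i).        *)
Definition crd (i : nat) (v : V) : F := [seq coord e j v | j <- enum 'I_n]`_i.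

(* With W = {x_0 = 0}, the point [1, x] for x in W.                           *)
Definition affine_point (W : {vspace V}) (x : subvs_of W) : {vspace V} :=
  <[e`_0 + vsval x]>%VS.

End Coordinates.

Section Hyperplane.
Variables (F : fieldType) (V : vectType F) (xi : {symmetric V}).
Variable W : {vspace V}.

Definition restr_form (x y : subvs_of W) : F := xi (vsval x) (vsval y).

(* The action <u> |-> <phi u> on the points of W preserves perpendicularity.  *)
Definition preserves_perp (phi : subvs_of W -> subvs_of W) : Prop :=
  forall u v : subvs_of W, u != 0 -> v != 0 ->
    (perp xi <[vsval u]>%VS <[vsval v]>%VS <->
     perp xi <[vsval (phi u)]>%VS <[vsval (phi v)]>%VS).

End Hyperplane.

Definition semilinear_bijection (F : fieldType) (U : lmodType F)
    (phi : U -> U) : Prop :=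
  exists sigma : {rmorphism F -> F},
    [/\ bijective sigma, linear_for (sigma \; *:%R) phi & bijective phi].

(* f, a self-map of W, is an automorphism of B1 once each vector x of W is    *)
(* identified with the point [1, x].                                          *)
Definition in_Aut_B1 (F : fieldType) (V : vectType F) (xi : {symmetric V})
    (b : {vspace V}) (n : nat) (e : n.-tuple V) (W : {vspace V})
    (f : subvs_of W -> subvs_of W) : Prop :=
  exists2 g : {vspace V} -> {vspace V}, automorphism (B1 xi b) g &
    forall x : subvs_of W, g (affine_point e x) = affine_point e (f x).

(* Main.v *)
From HB Require Import structures.
Require Import Defs.
From mathcomp Require Import all_boot all_order all_algebra.
From mathcomp Require Import sesquilinear.
From mathcomp Require Import boolp classical_sets functions.
From mathcomp Require Import ring.

(** The point [1, x] is represented by the vector e_0 + x, and c = e_1 spans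
    the pole of the hyperplane W, so that xi v v = (xi v c)^2 for all v.  The
    Gram matrix of [1, x] and [1, y] has ones on its diagonal, so its
    determinant is 1 - xi([1, x], [1, y])^2, and the line joining the two points
    is regular exactly when xi([1, x], [1, y]) <> 1 ([regular_join]).  Hence B_1
    is the affine space W from which some of the lines are removed, and its
    automorphisms are the bijections of W that preserve the relation
    [adjacent] and the affine lines joining adjacent points
    ([Aut_B1_collineation], [collineation_Aut_B1]).

    The main point is that the removed lines can be recovered from adjacency.
    The points w not adjacent to x are those with [1, w] orthogonal to
    [1, x] - c.  If x <> y are not adjacent, then z lies on the line x y if and
    only if every w that is adjacent neither to x nor to y is not adjacent to z
    ([nonadjacent_line]): since xi is nondegenerate, a vector orthogonal to
    everything orthogonal to [1, x] - c and [1, y] - c is a combination of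
    these two.  So an automorphism of B_1 preserves all affine lines, and the
    fundamental theorem of affine geometry ([fundamental_theorem_affine])
    makes it semiaffine, x |-> phi x + omega.

    The line through x with direction d is regular if and only if
    xi([1, x], d) <> 0.  In characteristic 2 the implication in (ii) says that
    f maps the lines which are not regular to lines which are not regular; the
    converse implication then holds because for fixed x the directions d with
    xi([1, x], d) = 0 form a hyperplane.  Finally,
    xi(u, v) = xi([1, x + u], v) - xi([1, x], v) expresses orthogonality in W
    by these conditions, whence phi preserves it
    ([collineation_preserves_perp]). *)

Set Implicit Arguments.
Unset Strict Implicit.
Unset Printing Implicit Defensive.

Import GRing.Theory.
Local Open Scope classical_set_scope.
Local Open Scope ring_scope.

(** * The fundamental theorem of affine geometry *)

Section FundamentalTheorem.
Variables (F : fieldType) (U : lmodType F).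

Definition on_line (x y z : U) : Prop := exists c : F, z = x + c *: (y - x).

Definition independent (u v : U) : Prop :=
  forall a b : F, a *: u + b *: v = 0 -> a = 0 /\ b = 0.

Lemma independentC u v : independent u v -> independent v u.
Proof. by move=> uv a b; rewrite addrC => /uv[-> ->]. Qed.

Lemma independent_neq0 u v : independent u v -> u <> 0.
Proof.
move=> uv u0; have /uv[/eqP] : 1 *: u + 0 *: v = 0.
  by rewrite u0 scaler0 scale0r addr0.
by rewrite oner_eq0.
Qed.

Lemma independentP u v : u <> 0 -> (forall c, v <> c *: u) -> independent u v.
Proof.
move=> u0 uv a b E; have [b0|b_neq0] := eqVneq b 0.
  split=> //; move: E; rewrite b0 scale0r addr0 => /eqP.
  by rewrite scaler_eq0 => /orP[/eqP|/eqP/u0].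
case: (uv (- (b^-1 * a))); rewrite scaleNr -scalerA.
apply: (scalerI b_neq0); rewrite scalerN scalerA divff // scale1r.
by apply/eqP; rewrite -addr_eq0 addrC E.
Qed.

Lemma on_line0 u v : on_line 0 u v <-> exists c, v = c *: u.
Proof. by split=> -[c ->]; exists c; rewrite subr0 add0r. Qed.

Section FixedOrigin.
Variables f g : U -> U.
Hypotheses (fK : cancel f g) (gK : cancel g f).
Hypothesis f_line : forall x y z, on_line x y z -> on_line (f x) (f y) (f z).
Hypothesis g_line : forall x y z, on_line x y z -> on_line (g x) (g y) (g z).
Hypothesis f0 : f 0 = 0.
Hypothesis F_gt2 : exists s : F, s != 0 /\ s != 1.
Hypothesis noncollinear : forall u : U, exists w, forall c, w <> c *: u.

Let g0 : g 0 = 0. Proof. by rewrite -f0 fK. Qed.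

Lemma fixed_origin_scale u c : exists d, f (c *: u) = d *: f u.
Proof. by apply/on_line0; rewrite -f0; apply/f_line/on_line0; exists c. Qed.

Lemma fixed_origin_scale_inv u c : exists d, g (c *: f u) = d *: u.
Proof.
apply/on_line0; rewrite -g0 -[u in on_line _ u]fK.
by apply/g_line/on_line0; exists c.
Qed.

Lemma fixed_origin_neq0 u : u <> 0 -> f u <> 0.
Proof. by move=> u0 fu0; apply: u0; rewrite -(fK u) fu0 g0. Qed.

Lemma fixed_origin_independent u v : independent u v -> independent (f u) (f v).
Proof.
move=> uv; apply: independentP.
  exact/fixed_origin_neq0/(independent_neq0 uv).
move=> c E; have [d] := fixed_origin_scale_inv u c; rewrite -E fK => Ev.
have /uv[_ /eqP] : d *: u + (- 1) *: v = 0 by rewrite Ev scaleN1r subrr.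
by rewrite oppr_eq0 oner_eq0.
Qed.

(** For scalars s other than 0 and 1, the point u + v is on the line joining
    s u with (s / (s - 1)) v, which are on the lines through the origin
    spanned by u and v. *)
Lemma fixed_origin_add_span u v : independent u v ->
  exists a b, f (u + v) = a *: f u + b *: f v.
Proof.
move=> uv; have [s [s0 s1]] := F_gt2.
have s1' : s - 1 != 0 by rewrite subr_eq0.
have [a fa] := fixed_origin_scale u s.
have [b fb] := fixed_origin_scale v (s / (s - 1)).
have : on_line (s *: u) ((s / (s - 1)) *: v) (u + v).
  exists (1 - s^-1); rewrite scalerBr !scalerA addrCA -scalerBl addrC.
  have -> : s - (1 - s^-1) * s = 1 by field.
  have -> : (1 - s^-1) * (s / (s - 1)) = 1 by field; rewrite ?s0 ?s1'.
  by rewrite !scale1r.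
move=> /f_line[c ->]; rewrite fa fb.
exists (a - c * a), (c * b).
by rewrite scalerBr !scalerA addrCA -scalerBl addrC.
Qed.

(** The lines v F and u + v F are disjoint, hence so are their images.  If a
    were not 1, the image of the second one would meet the line spanned by
    f v. *)
Lemma fixed_origin_add_coef u v a b : independent u v ->
  f (u + v) = a *: f u + b *: f v -> a = 1.
Proof.
move=> uv E; apply/eqP/negP => /negP a1.
have a1' : 1 - a != 0 by rewrite subr_eq0 eq_sym.
have : on_line (f u) (f (u + v)) (((1 - a)^-1 * b) *: f v).
  exists (1 - a)^-1; rewrite E addrAC scalerDr scalerA addrA.
  rewrite -[X in _ + (_ *: (_ - X))]scale1r -scalerBl scalerA.
  rewrite -[X in X + (_ *: _)]scale1r -scalerDl.
  have -> : 1 + (1 - a)^-1 * (a - 1) = 0 by field.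
  by rewrite scale0r add0r.
move=> /g_line[c]; rewrite !fK addrAC subrr add0r => Eg.
have [d] := fixed_origin_scale_inv v ((1 - a)^-1 * b); rewrite Eg => Ed.
have /uv[/eqP] : 1 *: u + (c - d) *: v = 0.
  by rewrite scalerBl scale1r addrA Ed subrr.
by rewrite oner_eq0.
Qed.

Lemma fixed_origin_addI u v : independent u v -> f (u + v) = f u + f v.
Proof.
move=> uv; have [a [b E]] := fixed_origin_add_span uv.
have a1 := fixed_origin_add_coef uv E.
have b1 : b = 1.
  apply: (@fixed_origin_add_coef v u b a (independentC uv)).
  by rewrite addrC E addrC.
by rewrite E a1 b1 !scale1r.
Qed.

(** If v is a multiple of u, independence is restored by adding a third vector
    w outside the line spanned by u. *)
Lemma fixed_origin_add u v : f (u + v) = f u + f v.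
Proof.
have [->|/eqP u0] := eqVneq u 0; first by rewrite f0 !add0r.
have [[c Ev]|/forallNP h] := pselect (exists c, v = c *: u); last first.
  exact/fixed_origin_addI/independentP.
have [w uw] := noncollinear u.
have iuw := independentP u0 uw.
apply: (addIr (f w)).
have vw : f (v + w) = f v + f w.
  have [->|/eqP v0] := eqVneq v 0; first by rewrite f0 !add0r.
  apply: fixed_origin_addI; apply: independentP => // d; rewrite Ev scalerA.
  exact: uw.
have iuvw : independent u (v + w).
  apply: independentP => // d; rewrite Ev => E; apply: (uw (d - c)).
  by rewrite scalerBl -E addrC addKr.
rewrite -addrA -vw -(fixed_origin_addI iuvw) addrA.
have [uv0|/eqP uv0] := eqVneq (u + v) 0; first by rewrite uv0 f0 !add0r.
rewrite (@fixed_origin_addI (u + v) w) //; apply: independentP => // d.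
by rewrite Ev -{1}[u]scale1r -scalerDl scalerA; apply: uw.
Qed.

(** The scalar by which f acts on c u is the same for independent vectors u
    and v, as it can be compared with the one for u + v. *)
Lemma fixed_origin_scale_eq u v c d : independent u v ->
  f (c *: u) = d *: f u -> f (c *: v) = d *: f v.
Proof.
move=> uv fu; have [d' fv] := fixed_origin_scale v c.
have [d'' fuv] := fixed_origin_scale (u + v) c.
have /(fixed_origin_independent uv)[] :
    (d'' - d) *: f u + (d'' - d') *: f v = 0.
  rewrite !scalerBl addrACA -scalerDr -fixed_origin_add -fuv scalerDr.
  by rewrite fixed_origin_add fu fv -opprD subrr.
by move=> /subr0_eq <- /subr0_eq ->.
Qed.

Lemma fixed_origin_semilinear : semilinear_bijection f.
Proof.
have [u /(_ 0)] := noncollinear 0; rewrite scaler0 => u0.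
have [w uw] := noncollinear u.
have iuw := independentP u0 uw.
have fu0 : f u != 0 by apply/eqP; apply: fixed_origin_neq0.
have [s fs] := choice (fixed_origin_scale u).
have [t gt] := choice (fixed_origin_scale_inv u).
have fZ c v : f (c *: v) = s c *: f v.
  have [->|/eqP v0] := eqVneq v 0; first by rewrite !(f0, scaler0).
  have [[d Ev]|/forallNP h] := pselect (exists d, v = d *: u); last first.
    exact: fixed_origin_scale_eq (independentP u0 h) (fs c).
  have : independent v w.
    by apply: independentP => // b; rewrite Ev scalerA; apply: uw.
  move=> /independentC/fixed_origin_scale_eq; apply.
  exact: fixed_origin_scale_eq iuw (fs c).
have fN v : f (- v) = - f v.
  by apply/eqP; rewrite -addr_eq0 -fixed_origin_add addNr f0.
have sI a b : a *: f u = b *: f u -> a = b.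
  move=> /eqP; rewrite -subr_eq0 -scalerBl scaler_eq0 (negPf fu0) orbF subr_eq0.
  by move=> /eqP.
have sB : zmod_morphism s.
  by move=> a b; apply: sI; rewrite -fs !scalerBl fixed_origin_add fN !fs.
have sM : monoid_morphism s.
  split; first by apply: sI; rewrite -fs !scale1r.
  by move=> a b; apply: sI; rewrite -fs -!scalerA fZ fs.
pose m1 := GRing.isZmodMorphism.Build F F s sB.
pose m2 := GRing.isMonoidMorphism.Build F F s sM.
pose S : {rmorphism F -> F} := HB.pack s m1 m2.
exists S; split.
- exists t => c.
    have := gt (s c); rewrite -fs fK => /eqP; rewrite -subr_eq0 -scalerBl.
    by rewrite scaler_eq0 subr_eq0 => /orP[/eqP <-|/eqP].
  by apply: sI; rewrite -[S _]/(s _) -fs -gt gK.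
- by move=> c x y; rewrite fixed_origin_add fZ.
- by exists g.
Qed.

End FixedOrigin.

(** A scalar other than 0 and 1 is required: over the field with two elements
    every bijection preserves lines, while in dimension at least 3 not every
    bijection is affine. *)
Theorem fundamental_theorem_affine (f g : U -> U) :
    cancel f g -> cancel g f ->
    (forall x y z, on_line x y z -> on_line (f x) (f y) (f z)) ->
    (forall x y z, on_line x y z -> on_line (g x) (g y) (g z)) ->
    (exists s : F, s != 0 /\ s != 1) ->
    (forall u : U, exists w, forall c, w <> c *: u) ->
  semilinear_bijection (fun x => f x - f 0).
Proof.
move=> fK gK fL gL F2 nc.
apply: (@fixed_origin_semilinear _ (fun x => g (x + f 0))) => //=.
- by move=> x; rewrite subrK fK.
- by move=> x; rewrite gK addrK.
- move=> x y z /fL[c ->]; exists c.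
  by rewrite opprD opprK addrACA addNr addr0 addrAC.
- move=> x y z [c ->]; apply: gL; exists c.
  by rewrite opprD addrACA subrr addr0 addrAC.
- by rewrite subrr.
Qed.
End FundamentalTheorem.

(** * Symmetric bilinear forms and regular subspaces *)

Lemma inj_surj_bijective (T : Type) (f : T -> T) : injective f ->
  (forall y, exists x, f x = y) -> bijective f.
Proof.
move=> fI /choice[g gK]; exists g => // x; exact/fI.
Qed.

Section SymmetricForm.
Variables (F : fieldType) (V : vectType F) (xi : {symmetric V}).

Lemma sformDl u v w : xi (u + v) w = xi u w + xi v w.
Proof. exact: linearDl. Qed.

Lemma sformDr u v w : xi w (u + v) = xi w u + xi w v.
Proof. exact: linearDr. Qed.

Lemma sformZl a u w : xi (a *: u) w = a * xi u w.
Proof. exact: linearZl_LR. Qed.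

Lemma sformZr a u w : xi w (a *: u) = a * xi w u.
Proof. exact: linearZr_LR. Qed.

Lemma sformBl u v w : xi (u - v) w = xi u w - xi v w.
Proof. exact: linearBl. Qed.

Lemma sformBr u v w : xi w (u - v) = xi w u - xi w v.
Proof. exact: linearBr. Qed.

Lemma sform0l w : xi 0 w = 0.
Proof. exact: linear0l. Qed.

Lemma sformC u v : xi u v = xi v u.
Proof. by rewrite hermC expr0 mul1r. Qed.

Lemma nondegenerate_eq0 v : nondegenerate xi ->
  (forall u, xi u v = 0) -> v = 0.
Proof.
move=> /eqP nd h; apply/eqP; rewrite -memv0 -nd.
by apply/mem_orthovP => u _; rewrite sformC.
Qed.

Lemma perp_vlineP u v : perp xi <[u]>%VS <[v]>%VS <-> xi u v = 0.
Proof.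
split=> [|uv0 _ _ /vlineP[a ->] /vlineP[b ->]].
  by apply; apply: memv_line.
by rewrite sformZl sformZr uv0 !mulr0.
Qed.

Lemma ppointP (p : {vspace V}) : ppoint p -> exists2 v, v != 0 & p = <[v]>%VS.
Proof.
rewrite /ppoint /= => dp; have p0 : vpick p != 0.
  by rewrite vpick0 -dimv_eq0 dp.
exists (vpick p) => //; apply/esym/eqP; rewrite eqEdim -memvE memv_pick dp.
by rewrite dim_vline p0.
Qed.

Lemma ppoint_vline (v : V) : v != 0 -> ppoint <[v]>%VS.
Proof. by move=> v0; rewrite /ppoint /= dim_vline v0. Qed.

Lemma regularP (U : {vspace V}) : regular xi U <->
  forall v, v \in U -> (forall u, u \in U -> xi u v = 0) -> v = 0.
Proof.
split=> [reg v vU vperp|h].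
  apply/eqP/negP => /negP v0.
  suff : (points_on U `&` perp_set xi U) <[v]>%VS by rewrite reg.
  split; first by split; [exact: ppoint_vline|rewrite -memvE].
  split=> [|q [_ qU] _ w /vlineP[a ->] wq]; first exact: ppoint_vline.
  by rewrite sformZl sformC vperp ?mulr0 // (subvP qU).
apply/seteqP; split=> // p [[/ppointP[v v0 ->] vU] [_ vperp]].
move/eqP: v0; apply; apply: h; first by rewrite memvE.
move=> u uU; have [->|u0] := eqVneq u 0; first by rewrite sform0l.
rewrite sformC; apply/perp_vlineP/vperp; split; first exact: ppoint_vline.
by rewrite -memvE.
Qed.

(** Under a nondegenerate form, <u, v> is the double orthogonal of itself.  This
    is proved by elimination on the functionals xi _ u and xi _ v, so that it
    holds whether or not u and v are independent. *)
Lemma form_kernels_sub u v w : nondegenerate xi ->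
  (forall z, xi z u = 0 -> xi z v = 0 -> xi z w = 0) ->
  exists a b, w = a *: u + b *: v.
Proof.
move=> nd.
have one u' w' : (forall z, xi z u' = 0 -> xi z w' = 0) ->
    exists a, w' = a *: u'.
  move=> h; have [[y yu]|/forallNP h0] := pselect (exists y, xi y u' <> 0).
    have {}yu : xi y u' != 0 by apply/eqP.
    exists (xi y w' / xi y u'); apply/eqP; rewrite -subr_eq0; apply/eqP.
    apply: nondegenerate_eq0 => // z.
    have := h (z - (xi z u' / xi y u') *: y).
    rewrite !sformBl !sformZl divfK // subrr => /(_ erefl) E.
    by rewrite sformBr sformZr -E; field.
  exists 0; rewrite scale0r; apply: nondegenerate_eq0 => // z; apply: h.
  exact: contrapT (h0 z).
move=> h; have [[y [yu yv]]|/forallNP h0] :=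
  pselect (exists y, xi y u = 0 /\ xi y v <> 0).
  have {}yv : xi y v != 0 by apply/eqP.
  have [|a E] := one u (w - (xi y w / xi y v) *: v).
    move=> z zu; have := h (z - (xi z v / xi y v) *: y).
    rewrite !sformBl !sformZl zu yu mulr0 subrr divfK // subrr.
    by move=> /(_ erefl erefl) E; rewrite sformBr sformZr -E; field.
  by exists a, (xi y w / xi y v); rewrite -E subrK.
have [|a ->] := one u w; last by exists a, 0; rewrite scale0r addr0.
by move=> z zu; apply: h => //; apply: contrapT => zv; case: (h0 z).
Qed.

End SymmetricForm.

(** * The regular points and lines as an affine structure *)

Section AffineModel.
Variables (F : fieldType) (V : vectType F) (xi : {symmetric V}).
Variables (n : nat) (e : n.-tuple V) (W : {vspace V}) (c : V).
Hypothesis pchar2 : 2%N \in [pchar F].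
Hypothesis nondeg : nondegenerate xi.
Hypothesis xi_self : forall v, xi v v = xi v c ^+ 2.
Hypothesis xi_e0c : xi e`_0 c = 1.
Hypothesis memW : forall v, v \in W <-> xi v c = 0.

Implicit Types (x y z w : subvs_of W) (l : {vspace V}).

(** The representative of the point [1, x] on which the functional xi _ c, the
    coordinate x_0, takes the value 1. *)
Definition affine_vector x : V := e`_0 + vsval x.
Local Notation "[ 1 , x ]" := (affine_vector x) (at level 0, format "[ 1 ,  x ]").

(** Collinearity of distinct points in B_1, see [adjacentP].  As xi [1, x] [1, x]
    is 1, a point is not adjacent to itself. *)
Definition adjacent x y : Prop := xi [1, x] [1, y] != 1.

Definition join x y : {vspace V} := (<[ [1, x] ]> + <[ [1, y] ]>)%VS.

Lemma xi_subvs_c x : xi (vsval x) c = 0.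
Proof. by apply/memW; apply: subvsP. Qed.

Lemma xi_affine_c x : xi [1, x] c = 1.
Proof. by rewrite sformDl xi_e0c xi_subvs_c addr0. Qed.

Lemma xi_affine_self x : xi [1, x] [1, x] = 1.
Proof. by rewrite xi_self xi_affine_c expr1n. Qed.

Lemma affine_vector_neq0 x : [1, x] != 0.
Proof.
by apply/eqP => x0; move/eqP: (xi_affine_c x); rewrite x0 sform0l eq_sym oner_eq0.
Qed.

Lemma affine_vectorB x y : [1, y] - [1, x] = vsval (y - x).
Proof. by rewrite linearB /= opprD addrACA subrr add0r. Qed.

Lemma affine_vectorD x d : [1, x + d] = [1, x] + vsval d.
Proof. by rewrite /affine_vector linearD /= addrA. Qed.

Lemma affine_vector_inj : injective affine_vector.
Proof. by move=> x y /addrI/val_inj. Qed.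

Lemma affine_vector_comb x y a :
  [1, x + a *: (y - x)] = (1 - a) *: [1, x] + a *: [1, y].
Proof.
rewrite scalerBl scale1r -addrA [- _ + _]addrC -scalerBr affine_vectorB.
by rewrite affine_vectorD linearZ.
Qed.

Lemma affine_normalize v : xi v c != 0 -> exists x, v = xi v c *: [1, x].
Proof.
move=> v0; have vW : (xi v c)^-1 *: v - e`_0 \in W.
  by apply/memW; rewrite sformBl sformZl mulVf // xi_e0c subrr.
exists (vsproj W ((xi v c)^-1 *: v - e`_0)).
by rewrite /affine_vector vsprojK // addrCA subrr addr0 scalerA divff // scale1r.
Qed.

Lemma mem_affine_normalize v l : v \in l -> xi v c != 0 ->
  exists2 x, v = xi v c *: [1, x] & [1, x] \in l.
Proof.
move=> vl v0; have [x Ev] := affine_normalize v0; exists x => //.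
by move: vl; rewrite {1}Ev rpredZeq (negPf v0).
Qed.

Lemma affine_point_inj : injective (@affine_point F V n e W).
Proof.
move=> x y E; have : [1, x] \in <[ [1, y] ]>%VS by rewrite memvE -[X in (_ <= X)%VS]E.
move=> /vlineP[a Ea]; apply: affine_vector_inj; move: (xi_affine_c x).
by rewrite Ea sformZl xi_affine_c mulr1 => ->; rewrite scale1r.
Qed.

Lemma sub_affine_point x l : (affine_point e x <= l)%VS = ([1, x] \in l).
Proof. by rewrite memvE. Qed.

Lemma mem_join v x y : reflect (exists a b, v = a *: [1, x] + b *: [1, y])
  (v \in join x y).
Proof.
apply: (iffP memv_addP) => [[_ /vlineP[a ->] [_ /vlineP[b ->] ->]]|[a [b ->]]].
  by exists a, b.
exists (a *: [1, x]); first by rewrite memvZ // memv_line.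
by exists (b *: [1, y]); rewrite // memvZ // memv_line.
Qed.

Lemma mem_joinl x y : [1, x] \in join x y.
Proof. by apply/mem_join; exists 1, 0; rewrite scale1r scale0r addr0. Qed.

Lemma mem_joinr x y : [1, y] \in join x y.
Proof. by apply/mem_join; exists 0, 1; rewrite scale1r scale0r add0r. Qed.

Lemma affine_mem_join x y z : [1, z] \in join x y <-> on_line x y z.
Proof.
split=> [/mem_join[a [b E]]|[b ->]].
  exists b; apply: affine_vector_inj; rewrite affine_vector_comb E.
  suff -> : a = 1 - b by [].
  have := xi_affine_c z; rewrite E sformDl !sformZl !xi_affine_c !mulr1 => <-.
  by rewrite addrK.
by apply/mem_join; rewrite affine_vector_comb; exists (1 - b), b.
Qed.

Lemma dim_join x y : x <> y -> \dim (join x y) = 2%N.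
Proof.
move=> xy; rewrite dimv_disjoint_sum ?dim_vline ?affine_vector_neq0 //.
apply/eqP; rewrite -subv0; apply/subvP => _ /memv_capP[/vlineP[a ->]].
move=> /vlineP[b E]; rewrite memv0 E; suff -> : b = 0 by rewrite scale0r.
have := congr1 (xi^~ c) E; rewrite !sformZl !xi_affine_c !mulr1 => ab.
have [//|b0] := eqVneq b 0; case: xy; apply: affine_vector_inj.
by apply: (scalerI b0); rewrite -E ab.
Qed.

Lemma join_eq x y l : x <> y -> pline l -> [1, x] \in l -> [1, y] \in l ->
  l = join x y.
Proof.
move=> xy dl xl yl; apply/eqP; rewrite eq_sym eqEdim dim_join // dl leqnn andbT.
by rewrite subv_add -!memvE xl yl.
Qed.

Lemma adjacent_neq x y : adjacent x y -> x <> y.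
Proof. by move=> xy E; move: xy; rewrite /adjacent E xi_affine_self eqxx. Qed.

Variable b : {vspace V}.
Hypothesis selfconjugate_b : selfconjugate xi b.

Lemma selfconjugate_vline v : selfconjugate xi <[v]>%VS -> xi v c = 0.
Proof.
move=> [_ /perp_vlineP]; rewrite xi_self => /eqP.
by rewrite expf_eq0 => /andP[_ /eqP].
Qed.

Lemma B1_points p : pl_points (B1 xi b) p <-> exists x, p = affine_point e x.
Proof.
split=> [[/ppointP[v v0 ->] /regularP reg _]|[x ->]].
  have vc : xi v c != 0.
    apply/eqP => vc0; move/eqP: v0; apply; apply: reg; first exact: memv_line.
    by move=> _ /vlineP[a ->]; rewrite sformZl xi_self vc0 expr0n mulr0.
  have [x Ev] := affine_normalize vc; exists x.
  apply/eqP; rewrite eqEdim !dim_vline v0 affine_vector_neq0 andbT -memvE Ev.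
  by rewrite memvZ // memv_line.
split.
- exact/ppoint_vline/affine_vector_neq0.
- apply/regularP => _ /vlineP[a ->] /(_ _ (memv_line _)).
  by rewrite sformZr xi_affine_self mulr1 => ->; rewrite scale0r.
- move=> E; move: selfconjugate_b; rewrite -E => /selfconjugate_vline /eqP.
  by rewrite xi_affine_c oner_eq0.
Qed.

(** If xi [1, x] [1, y] = 1, the point at infinity [1, x] - [1, y] is orthogonal
    to the whole line.  Otherwise the Gram determinant 1 - q^2, with
    q = xi [1, x] [1, y], is (1 + q)^2 in characteristic 2 and does not vanish. *)
Lemma regular_join x y : x <> y -> regular xi (join x y) <-> adjacent x y.
Proof.
move=> xy; split=> [/regularP reg|adj].
  apply/eqP => xy1; apply/xy/affine_vector_inj/eqP; rewrite -subr_eq0; apply/eqP.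
  apply: reg => [|_ /mem_join[s [t ->]]].
    by rewrite rpredB ?mem_joinl ?mem_joinr.
  rewrite sformDl !sformZl !sformBr !xi_affine_self [xi [1, y] _]sformC xy1.
  by rewrite !subrr !mulr0 addr0.
apply/regularP => _ /mem_join[s [t ->]] h.
have := h _ (mem_joinl x y); have := h _ (mem_joinr x y).
rewrite !sformDr !sformZr !xi_affine_self [xi [1, y] _]sformC !mulr1.
set q := xi _ _ => E1 E2.
have q1 : (1 + q) ^+ 2 != 0.
  by rewrite expf_eq0 /= addrC addr_eq0 (oppr_pchar2 pchar2).
have t0 : t = 0.
  apply: (mulIf q1); rewrite mul0r.
  have -> : t * (1 + q) ^+ 2 = q * (s + t * q) + (s * q + t) + (t - s) * q *+ 2.
    by ring.
  by rewrite E1 E2 mulr0 addr0 add0r mulrn_pchar.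
move: E2; rewrite t0 mul0r addr0 => ->.
by rewrite !scale0r addr0.
Qed.

(** A line not contained in W has at most one point in W, so it is the join of
    two affine points. *)
Lemma B1_lines l : pl_lines (B1 xi b) l <->
  exists x y, adjacent x y /\ l = join x y.
Proof.
split=> [[dl reg nself]|[x [y [xy ->]]]].
  have [v vl vc] : exists2 v, v \in l & xi v c != 0.
    apply/not_exists2P => h; apply: nself => _ [/ppointP[v v0 ->] vl].
    split; first exact: ppoint_vline.
    apply/perp_vlineP; have := h v; rewrite memvE xi_self => -[//|].
    by move=> /negP/negPn/eqP ->; rewrite expr0n.
  have [x _ xl] := mem_affine_normalize vl vc.
  have [d dl' dx] : exists2 d, d \in l & d \notin <[ [1, x] ]>%VS.
    apply/subvPn/negP => /dimvS; rewrite dl dim_vline.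
    by case: (_ == _).
  (* A direction d in W is replaced by the affine point d + [1, x]. *)
  have [w wl [wc wx]] : exists2 w, w \in l & xi w c != 0 /\ w \notin <[ [1, x] ]>%VS.
    have [dc|dc] := eqVneq (xi d c) 0; last by exists d.
    exists (d + [1, x]); first by rewrite rpredD.
    by rewrite sformDl dc xi_affine_c add0r oner_eq0 rpredDr ?memv_line.
  have [y Ew yl] := mem_affine_normalize wl wc.
  have xy : x <> y.
    by move=> xy; move: wx; rewrite Ew xy memvZ // memv_line.
  have El := join_eq xy dl xl yl; exists x, y; split=> //.
  by apply/(regular_join xy); rewrite -El.
have xy' := adjacent_neq xy; split.
- exact: dim_join.
- exact/regular_join.
- move=> /(_ <[ [1, x] ]>%VS) []; last first.
    by move=> _ /perp_vlineP/eqP; rewrite xi_affine_self oner_eq0.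
  split; first exact/ppoint_vline/affine_vector_neq0.
  by rewrite -memvE mem_joinl.
Qed.


Lemma adjacentP x y : adjacent x y <-> x <> y /\
  exists l, [/\ pl_lines (B1 xi b) l, [1, x] \in l & [1, y] \in l].
Proof.
split=> [xy|[xy [l [ll xl yl]]]].
  split; first exact: adjacent_neq.
  exists (join x y); split; rewrite ?mem_joinl ?mem_joinr //.
  by apply/B1_lines; exists x, y.
have [dl reg _] := ll.
by apply/(regular_join xy); rewrite -(join_eq xy dl xl yl).
Qed.

Definition regular_collineation (f : subvs_of W -> subvs_of W) : Prop :=
  forall x y, (adjacent x y <-> adjacent (f x) (f y)) /\
    (adjacent x y ->
       forall z, on_line x y z <-> on_line (f x) (f y) (f z)).

Lemma regular_collineation_inv f g : cancel g f ->
  regular_collineation f -> regular_collineation g.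
Proof.
move=> gK cf x y; have [adj line] := cf (g x) (g y); rewrite !gK in adj line.
split=> [|xy z]; first exact: iff_sym.
by apply: iff_sym; rewrite -{2}(gK z); apply: line; apply/adj.
Qed.

Lemma Aut_B1_collineation f :
  in_Aut_B1 xi b e f -> bijective f /\ regular_collineation f.
Proof.
move=> [g [[gfun ginj gsurj] [h [hfun hinj hsurj] gh]] gf].
have ptB x : pl_points (B1 xi b) (affine_point e x) by apply/B1_points; exists x.
have fbij : bijective f.
  apply: inj_surj_bijective => [x y fxy|y].
    by apply/affine_point_inj/ginj; rewrite ?inE ?gf ?fxy //; apply: ptB.
  have [_ /B1_points[x ->]] := gsurj _ (ptB y).
  by rewrite gf => /affine_point_inj <-; exists x.
have inc x l : pl_lines (B1 xi b) l -> ([1, x] \in l) = ([1, f x] \in h l).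
  move=> ll; have := gh _ _ (ptB x) ll; rewrite /= gf !sub_affine_point => E.
  by apply/idP/idP => /E.
split=> // x y.
have adj : adjacent x y <-> adjacent (f x) (f y).
  rewrite !adjacentP; split=> -[xy [l [ll xl yl]]].
    split=> [/(bij_inj fbij)//|]; exists (h l); rewrite -!inc //.
    by split=> //; apply: hfun.
  split=> [xy'|]; first by apply: xy; rewrite xy'.
  have [l' ll' El] := hsurj _ ll; exists l'.
  by split=> //; rewrite inc // El.
split=> // xy z; have xy' := (adj.1 xy).
have ll : pl_lines (B1 xi b) (join x y) by apply/B1_lines; exists x, y.
have [dl _ _] := hfun _ ll.
have El : h (join x y) = join (f x) (f y).
  apply: join_eq => //; first exact: adjacent_neq.
    by rewrite -inc ?mem_joinl.
  by rewrite -inc ?mem_joinr.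
by rewrite -!affine_mem_join inc // El.
Qed.

(** Since a line of B_1 is determined by its affine points, its image can be
    chosen as any line of B_1 whose affine points are the images under f. *)
Lemma collineation_Aut_B1 f :
  bijective f -> regular_collineation f -> in_Aut_B1 xi b e f.
Proof.
move=> fbij cf.
have /choice[g gf] : forall p : {vspace V}, exists q : {vspace V},
    forall x, p = affine_point e x -> q = affine_point e (f x).
  move=> p; have [[x ->]|/forallNP np] := pselect (exists x, p = affine_point e x).
    by exists (affine_point e (f x)) => y /affine_point_inj ->.
  by exists p => x /np.
have /choice[h hP] : forall l, exists l', pl_lines (B1 xi b) l ->
    pl_lines (B1 xi b) l' /\ forall x, [1, x] \in l <-> [1, f x] \in l'.
  move=> l; have [/B1_lines[x [y [xy ->]]]|nl] := pselect (pl_lines (B1 xi b) l).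
    exists (join (f x) (f y)) => _; have [adj line] := cf x y; split.
      by apply/B1_lines; exists (f x), (f y); split=> //; apply/adj.
    by move=> z; rewrite !affine_mem_join; apply: line.
  by exists l => /nl.
have ptB x : pl_points (B1 xi b) (affine_point e x) by apply/B1_points; exists x.
have gpt x : g (affine_point e x) = affine_point e (f x) by apply: gf.
have [f' fK f'K] := fbij.
exists g => //; split.
  split.
  - by move=> _ /B1_points[x ->]; rewrite gpt; apply: ptB.
  - move=> p q; rewrite !inE => /B1_points[x ->] /B1_points[y ->].
    by rewrite !gpt => /affine_point_inj/(bij_inj fbij) ->.
  - move=> _ /B1_points[y ->]; exists (affine_point e (f' y)); first exact: ptB.
    by rewrite gpt f'K.
exists h; last first.
  move=> _ l /B1_points[x ->] ll; rewrite gpt /= !sub_affine_point.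
  exact: (hP l ll).2.
split.
- by move=> l ll; apply: (hP l ll).1.
- move=> l l'; rewrite !inE => ll ll' hl.
  have /B1_lines[x [y [xy El]]] := ll.
  have [_ P] := hP _ ll; have [_ P'] := hP _ ll'.
  have [dl' _ _] := ll'.
  rewrite El; apply/esym/join_eq => //; first exact: adjacent_neq.
    by apply/P'; rewrite -hl; apply/P; rewrite El mem_joinl.
  by apply/P'; rewrite -hl; apply/P; rewrite El mem_joinr.
- move=> l /B1_lines[x [y [xy ->]]].
  have xy' : adjacent (f' x) (f' y) by apply/(cf _ _).1; rewrite !f'K.
  have ll : pl_lines (B1 xi b) (join (f' x) (f' y)).
    by apply/B1_lines; exists (f' x), (f' y).
  have [ll' P] := hP _ ll; have [dl' _ _] := ll'.
  exists (join (f' x) (f' y)) => //; apply: join_eq => //.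
  + exact: adjacent_neq.
  + by rewrite -[x in [1, x]]f'K; apply/P/mem_joinl.
  + by rewrite -[y in [1, y]]f'K; apply/P/mem_joinr.
Qed.

Hypothesis xi_cc : xi c c = 0.

Lemma nonadjacent_perp x y : ~ adjacent x y <-> xi [1, x] ([1, y] - c) = 0.
Proof.
rewrite /adjacent sformBr xi_affine_c; split=> [/negP/negPn/eqP ->|].
  by rewrite subrr.
by move=> /eqP; rewrite subr_eq0 => ->.
Qed.

Lemma xi_polar_c x : xi ([1, x] - c) c = 1.
Proof. by rewrite sformBl xi_affine_c xi_cc subr0. Qed.

(** This recovers the lines missing in B_1 from adjacency.  The vectors orthogonal
    to both [1, x] - c and [1, y] - c are orthogonal to [1, z] - c as well,
    provided that those of the form [1, w] are, and that there is at least one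
    [1, w] among them.  There is one, for otherwise c would be a combination of
    [1, x] - c and [1, y] - c, hence a multiple of their difference, which is
    orthogonal to [1, x] while c is not. *)
Lemma nonadjacent_line x y z : x <> y -> ~ adjacent x y ->
  on_line x y z <->
  forall w, ~ adjacent w x -> ~ adjacent w y -> ~ adjacent w z.
Proof.
move=> xNy nxy; split=> [[a ->] w /negP/negPn/eqP wx /negP/negPn/eqP wy|h].
  by rewrite /adjacent affine_vector_comb sformDr !sformZr wx wy !mulr1 subrK eqxx.
(* A point [1, w] orthogonal to both [1, x] - c and [1, y] - c *)
have [w [wx wy]] : exists w, ~ adjacent w x /\ ~ adjacent w y.
  apply: contrapT => nw.
  have [u ux uy|a [a' Ec]] :=
      form_kernels_sub (u := [1, x] - c) (v := [1, y] - c) (w := c) nondeg.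
    apply: contrapT => /eqP uc; apply: nw.
    have [w Eu] := affine_normalize uc; exists w; rewrite !nonadjacent_perp.
    move: ux uy; rewrite Eu !sformZl => /eqP ux /eqP uy; split; apply/eqP.
      by move: ux; rewrite mulf_eq0 (negPf uc).
    by move: uy; rewrite mulf_eq0 (negPf uc).
  have := congr1 (xi^~ c) Ec; rewrite xi_cc sformDl !sformZl !xi_polar_c !mulr1.
  move=> /esym/eqP; rewrite addr_eq0 => /eqP Ea; move: nxy.
  rewrite nonadjacent_perp => E.
  have := congr1 (xi [1, x]) Ec; rewrite xi_affine_c sformDr !sformZr E.
  rewrite sformBr xi_affine_self xi_affine_c subrr !mulr0 addr0 => /eqP.
  by rewrite oner_eq0.
have key v : xi v ([1, x] - c) = 0 -> xi v ([1, y] - c) = 0 ->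
    xi v c != 0 -> xi v ([1, z] - c) = 0.
  move=> vx vy vc; have [w' Ev] := affine_normalize vc.
  move: vx vy; rewrite Ev !sformZl => /eqP; rewrite mulf_eq0 (negPf vc) => /eqP vx.
  move=> /eqP; rewrite mulf_eq0 (negPf vc) => /eqP vy.
  have /nonadjacent_perp -> : ~ adjacent w' z by apply: h; apply/nonadjacent_perp.
  by rewrite mulr0.
have [v vx vy|a [a' Ez]] := form_kernels_sub (u := [1, x] - c)
    (v := [1, y] - c) (w := [1, z] - c) nondeg.
  (* Vectors v of W are handled by passing to v + [1, w]. *)
  have [vc|/key] := eqVneq (xi v c) 0; last exact.
  have wz := h w wx wy; move: wx wy wz; rewrite !nonadjacent_perp => wx wy wz.
  have := key (v + [1, w]); rewrite !(sformDl xi v) vx vy wx wy wz vc xi_affine_c !addr0.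
  by rewrite add0r oner_eq0; apply.
have := congr1 (xi^~ c) Ez; rewrite xi_polar_c sformDl !sformZl !xi_polar_c !mulr1 => Ea.
apply/affine_mem_join/mem_join; exists a, a'; apply: (addIr (- c)).
rewrite Ez !scalerBr addrACA -opprD -scalerDl -Ea scale1r; exact: erefl.
Qed.

Lemma collineation_line f g : cancel f g -> cancel g f -> regular_collineation f ->
  forall x y z, on_line x y z -> on_line (f x) (f y) (f z).
Proof.
move=> fK gK cf x y z; have [adj line] := cf x y.
have [xy|nxy] := pselect (adjacent x y); first exact: (line xy z).1.
have [->|xNy] := pselect (x = y).
  by move=> [a ->]; exists 0; rewrite subrr scaler0 addr0 scale0r addr0.
move=> /(nonadjacent_line _ xNy nxy) h.
have fxNy : f x <> f y by move=> /(can_inj fK).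
apply/nonadjacent_line => // [/adj//|w].
have adjw u : adjacent w (f u) <-> adjacent (g w) u.
  by rewrite (cf (g w) u).1 gK.
by rewrite !adjw; apply: h.
Qed.

Lemma adjacentD x d : adjacent x (x + d) <-> xi [1, x] (vsval d) <> 0.
Proof.
rewrite /adjacent affine_vectorD (sformDr xi [1, x]).
by rewrite xi_affine_self -subr_eq0 addrC addKr; split=> /eqP.
Qed.

Lemma xi_affineD x u v : xi [1, x + u] v = xi [1, x] v + xi (vsval u) v.
Proof. by rewrite affine_vectorD (sformDl xi [1, x]). Qed.

(** The functional x |-> xi [1, x] v is affine in x, with linear part xi _ v; it
    vanishes somewhere unless its linear part is zero. *)
Lemma xi_affine_solve (u : subvs_of W) v :
  xi (vsval u) v <> 0 -> exists x, xi [1, x] v = 0.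
Proof.
move=> /eqP uv; exists (- (xi e`_0 v / xi (vsval u) v) *: u).
by rewrite /affine_vector [vsval _]linearZ sformDl sformZl mulNr divfK // subrr.
Qed.

(** If xi [1, x] v vanishes for some x, then xi u v = xi [1, x + u] v says that
    u is orthogonal to v if and only if the line through x + u with direction v
    is not regular, a condition preserved by f.  Otherwise v is orthogonal to
    W, and so is phi v. *)
Lemma collineation_preserves_perp f phi : (forall y, exists x, f x = y) ->
  regular_collineation f -> (forall x d, f (x + d) = f x + phi d) ->
  preserves_perp xi phi.
Proof.
move=> fsurj cf fD u v _ _; rewrite !perp_vlineP.
have T x d : xi [1, x] (vsval d) = 0 <-> xi [1, f x] (vsval (phi d)) = 0.
  have := (cf x (x + d)).1; rewrite fD !adjacentD => E.
  by split=> h; apply: contrapT => /E; apply.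
have [[x xv]|/forallNP nx] := pselect (exists x, xi [1, x] (vsval v) = 0).
  have := T (x + u) v; rewrite fD !xi_affineD xv.
  by rewrite ((T x v).1 xv) !add0r.
have -> : xi (vsval u) (vsval v) = 0.
  by apply: contrapT => /xi_affine_solve[x /nx].
split=> // _; apply: contrapT => /xi_affine_solve[y].
by have [x <-] := fsurj y; rewrite -T => /nx.
Qed.

(** The last hypothesis is an implication, but the equivalence follows: for fixed
    x the solutions of xi [1, x] d = 0 form a hyperplane of W, so if phi mapped
    a further vector into the solutions for f x, it would map all of W there;
    but c is not a solution, as xi [1, f x] c = 1. *)
Lemma semilinear_collineation f phi omega : semilinear_bijection phi ->
  (forall x, f x = phi x + omega) ->
  (forall x y, xi [1, x] (vsval y) = 0 -> xi [1, f x] (vsval (phi y)) = 0) ->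
  bijective f /\ regular_collineation f.
Proof.
move=> [s [[t sK tK] lin [psi phiK psiK]]] fE hT.
have phiD u v : phi (u + v) = phi u + phi v.
  by have := lin 1 u v; rewrite /= rmorph1 !scale1r.
have phi0 : phi 0 = 0 by apply: (addrI (phi 0)); rewrite -phiD !addr0.
have phiZ a u : phi (a *: u) = s a *: phi u.
  by have := lin a u 0; rewrite /= phi0 !addr0.
have fD x d : f (x + d) = f x + phi d by rewrite !fE phiD addrAC.
have fbij : bijective f.
  exists (fun y => psi (y - omega)) => [x|y]; first by rewrite fE addrK.
  by rewrite fE psiK subrK.
have T x d : xi [1, x] (vsval d) = 0 <-> xi [1, f x] (vsval (phi d)) = 0.
  split; first exact: hT.
  move=> fxd; apply: contrapT => /eqP xd.
  have cW : c \in W by apply/memW.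
  have : xi [1, f x] (vsval (phi (psi (vsproj W c)))) = 1.
    by rewrite psiK vsprojK // xi_affine_c.
  set y := psi _; pose a := xi [1, x] (vsval y) / xi [1, x] (vsval d).
  have -> : vsval (phi y) = vsval (phi (y - a *: d)) + s a *: vsval (phi d).
    by rewrite -linearZ -linearD -phiZ -phiD subrK.
  rewrite sformDr sformZr fxd mulr0 addr0 hT.
    by move=> /esym/eqP; rewrite oner_eq0.
  have -> : vsval (y - a *: d) = vsval y - a *: vsval d by rewrite linearB linearZ.
  by rewrite sformBr sformZr divfK // subrr.
split=> // x y.
have adj : adjacent x y <-> adjacent (f x) (f y).
  have -> : y = x + (y - x) by rewrite addrC subrK.
  by rewrite fD !adjacentD T.
split=> // _ z.
have fline a : f (x + a *: (y - x)) = f x + s a *: (f y - f x).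
  rewrite fD phiZ; congr (_ + _ *: _).
  by have := fD x (y - x); rewrite [x + _]addrC subrK => ->; rewrite addrAC subrr add0r.
split=> [[a ->]|[a E]]; first by exists (s a).
by exists (t a); apply: (bij_inj fbij); rewrite fline tK.
Qed.

Hypothesis F_gt2 : exists s : F, s != 0 /\ s != 1.
Hypothesis noncollinear : forall u : subvs_of W, exists w, forall a, w <> a *: u.

Theorem Aut_B1P f : in_Aut_B1 xi b e f <->
  exists phi omega, [/\ semilinear_bijection phi,
    forall x, f x = phi x + omega,
    preserves_perp xi phi &
    forall x y, xi [1, x] (vsval y) = 0 -> xi [1, f x] (vsval (phi y)) = 0].
Proof.
split=> [/Aut_B1_collineation[[g fK gK] cf]|[phi [omega [sl fE _ hT]]]]; last first.
  by have [] := semilinear_collineation sl fE hT; apply: collineation_Aut_B1.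
have cg := regular_collineation_inv gK cf.
have fL := collineation_line fK gK cf; have gL := collineation_line gK fK cg.
have sl := fundamental_theorem_affine fK gK fL gL F_gt2 noncollinear.
have [s [_ lin _]] := sl.
have fD x d : f (x + d) = f x + (f d - f 0).
  have := lin 1 x d; rewrite /= rmorph1 !scale1r => /(canRL (subrK _)) ->.
  by rewrite addrAC subrK.
exists (fun x => f x - f 0), (f 0); split=> //.
- by move=> x; rewrite subrK.
- by apply: (@collineation_preserves_perp f) => // y; exists (g y).
- move=> x y xy; have := (cf x (x + y)).1; rewrite fD !adjacentD => E.
  by apply: contrapT => /E; apply.
Qed.

End AffineModel.

(** * Scalars and coordinates *)

(** Over the field with two elements, the line <u, v> has only the points <u>,
    <v> and <u + v>. *)
Lemma at_least_points_scalar (F : fieldType) (V : vectType F) (u v : V) m :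
  (3 < m)%N -> at_least_points m (<[u]> + <[v]>)%VS ->
  exists s : F, s != 0 /\ s != 1.
Proof.
move=> m3 [s [us sm sl]]; apply: contrapT => nF.
have F2 a : a = 0 \/ a = 1 :> F.
  have [|a0] := eqVneq a 0; first by left.
  have [|a1] := eqVneq a 1; first by right.
  by case: nF; exists a.
suff /(uniq_leq_size us) : {subset s <= [:: <[u]>%VS; <[v]>%VS; <[u + v]>%VS]}.
  by rewrite sm leqNgt m3.
move=> p /sl[/ppointP[w w0 ->]]; rewrite -memvE.
case/memv_addP => _ /vlineP[a ->] [_ /vlineP[a' ->] Ew].
move: w0; rewrite Ew !inE.
case: (F2 a) => ->; case: (F2 a') => ->; rewrite ?scale0r ?scale1r ?add0r ?addr0;
  by rewrite eqxx ?orbT.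
Qed.

Section Coordinates.
Variables (F : fieldType) (V : vectType F) (k : nat) (e : (2 * k).-tuple V).
Hypothesis k_gt0 : (0 < k)%N.
Hypothesis e_basis : basis_of fullv e.

Lemma crd_basis i j : (i < 2 * k)%N -> (j < 2 * k)%N ->
  crd e i e`_j = (i == j)%:R.
Proof.
move=> ik jk; rewrite /crd (nth_map (Ordinal ik)) ?size_enum_ord //.
rewrite -[j]/(nat_of_ord (Ordinal jk)) coord_free ?(basis_free e_basis) //.
by rewrite -val_eqE /= nth_enum_ord // eq_sym.
Qed.

Variable xi : {symmetric V}.
Hypothesis xiE : forall x y : V,
  xi x y = crd e 0 x * crd e 0 y +
    \sum_(0 <= i < k) (crd e (2 * i) x * crd e (2 * i).+1 y +
                       crd e (2 * i).+1 x * crd e (2 * i) y).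

Let lt2iS i : (i < k)%N -> ((2 * i).+1 < 2 * k)%N.
Proof. by move=> ik; rewrite -[(2 * i).+2]/(2 + 2 * i)%N -mulnS leq_mul2l. Qed.

Let lt2i i : (i < k)%N -> (2 * i < 2 * k)%N.
Proof. by move=> /lt2iS/ltnW. Qed.

Let lt0k : (0 < 2 * k)%N := lt2i k_gt0.
Let lt1k : (1 < 2 * k)%N := lt2iS k_gt0.

Lemma form_e1 v : xi v e`_1 = crd e 0 v.
Proof.
rewrite xiE big_ltn // big_nat big1 => [|[//|i] /andP[_ ik]].
  by rewrite muln0 !crd_basis //= !mulr0 mulr1 add0r !addr0.
by rewrite !crd_basis ?lt2i ?lt2iS // mulnS !mulr0 addr0.
Qed.

Lemma form_e0 v : xi e`_0 v = crd e 0 v + crd e 1 v.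
Proof.
rewrite xiE big_ltn // big_nat big1 => [|i /andP[i0 ik]].
  by rewrite muln0 !crd_basis //= !mul1r mul0r !addr0.
by rewrite !crd_basis ?lt2i ?lt2iS // muln_eq0 /= eqn0Ngt i0 !mul0r addr0.
Qed.

Lemma form_self v : 2%N \in [pchar F] -> xi v v = crd e 0 v ^+ 2.
Proof.
move=> pchar2; rewrite xiE big1 ?addr0 // => i _.
by rewrite [X in _ + X]mulrC (addrr_pchar2 pchar2).
Qed.

End Coordinates.

Theorem proposition3p24 (F : fieldType) (V : vectType F) (xi : {symmetric V})
    (b : {vspace V}) (k : nat) (e : (2 * k).-tuple V) (W : {vspace V})
    (f : subvs_of W -> subvs_of W)
    (hchar : 2%N \in [pchar F])
    (hperf : perfect_field F)
    (hlines : forall l : {vspace V}, pline l -> at_least_points 6 l)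
    (hnondeg : nondegenerate xi)
    (hnalt : ~ alternating xi)
    (hb : ppoint b)
    (hpole : perp_set xi b = selfconjugate xi)
    (hbH : selfconjugate xi b)
    (hk : (1 < k)%N)
    (he : basis_of fullv e)
    (hxi : forall x y : V,
       xi x y = crd e 0 x * crd e 0 y +
         \sum_(0 <= i < k) (crd e (2 * i) x * crd e (2 * i).+1 y +
                            crd e (2 * i).+1 x * crd e (2 * i) y))
    (hW : forall v : V, v \in W <-> crd e 0 v = 0) :
  in_Aut_B1 xi b e f <->
  exists (phi : subvs_of W -> subvs_of W) (omega : subvs_of W),
    [/\ semilinear_bijection phi,
        forall x, f x = phi x + omega,
        preserves_perp xi phi &
        forall x y : subvs_of W,
          restr_form xi x y = crd e 1 (vsval y) ->
          restr_form xi (phi x) (phi y) + restr_form xi omega (phi y) =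
            crd e 1 (vsval (phi y))].
Proof.
have k_gt0 : (0 < k)%N by apply: ltnW.
have k2 : (2 < 2 * k)%N by rewrite -[X in (X < _)%N](muln1 2) ltn_pmul2l.
have [k0 k1] : (0 < 2 * k)%N /\ (1 < 2 * k)%N by split; apply: ltn_trans k2.
have e1E := form_e1 k_gt0 he hxi.
have self v : xi v v = xi v e`_1 ^+ 2 by rewrite e1E (form_self hxi).
have e01 : xi e`_0 e`_1 = 1 by rewrite e1E (crd_basis he).
have e11 : xi e`_1 e`_1 = 0 by rewrite e1E (crd_basis he).
have memW v : v \in W <-> xi v e`_1 = 0 by rewrite e1E.
have W1 : e`_1 \in W by apply/hW; rewrite (crd_basis he).
have W2 : e`_2 \in W by apply/hW; rewrite (crd_basis he).
have noncol (u : subvs_of W) : exists w, forall a, w <> a *: u.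
  apply: contrapT => /forallNP nw.
  have mul w : exists a, w = a *: u.
    by apply: contrapT => /forallNP nu; case: (nw w).
  have [a Ea] := mul (vsproj W e`_1); have [a' Ea'] := mul (vsproj W e`_2).
  have Eu : e`_1 = a *: vsval u by have := congr1 vsval Ea; rewrite vsprojK // linearZ.
  have Eu' : e`_2 = a' *: vsval u by have := congr1 vsval Ea'; rewrite vsprojK // linearZ.
  have u0 : xi e`_0 (vsval u) != 0.
    apply/eqP => u0; move/eqP: e01; rewrite Eu sformZr u0 mulr0 eq_sym.
    by rewrite oner_eq0.
  have /eqP : xi e`_0 e`_2 = 0.
    by rewrite (form_e0 k_gt0 he hxi) !(crd_basis he) // addr0.
  rewrite Eu' sformZr mulf_eq0 (negPf u0) orbF => /eqP a'0.
  have /negP[] : e`_2 != 0.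
    by rewrite (free_not0 (basis_free he)) // mem_nth ?size_tuple.
  by rewrite Eu' a'0 scale0r.
have F_gt2 : exists s : F, s != 0 /\ s != 1.
  have [w /(_ 0) w0] := noncol 0.
  apply: (@at_least_points_scalar _ _ _ _ 6) => //; apply: hlines.
  by apply: (dim_join e01 memW (x := w) (y := 0)); rewrite -(scaler0 _ 0).
rewrite (Aut_B1P hchar hnondeg self e01 memW hbH e11 F_gt2 noncol).
have T (x y : subvs_of W) : xi (e`_0 + vsval x) (vsval y) =
    crd e 1 (vsval y) + restr_form xi x y.
  by rewrite sformDl (form_e0 k_gt0 he hxi) (hW _).1 ?subvsP // add0r.
have T0 (x y : subvs_of W) : xi (e`_0 + vsval x) (vsval y) = 0 <->
    restr_form xi x y = crd e 1 (vsval y).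
  rewrite T addrC; split=> [/eqP|->]; last exact: addrr_pchar2.
  by rewrite addr_eq0 oppr_pchar2 // => /eqP.
split=> -[phi [omega [sl fE pp h]]]; exists phi, omega; split=> // x y.
  move=> /T0/h/T0; rewrite fE /restr_form linearD sformDl //.
move=> /T0/h E; apply/T0; rewrite fE /restr_form linearD sformDl //.
Qed.
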